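(* Let $(A,\cdot,\bullet)$ be a two-sided skew brace with associative $\star$-product. The following conditions are equivalent: 1) $A$ is a bi-skew brace; 2) $\lambda:A^{\cdot}\to\operatorname{Aut}(A^{\cdot})$, $a\mapsto\lambda_a$, is a morphism of groups; 3) $P_3(A)=\{1\}$. In particular, if $(G,\cdot)$ is a group with $G/[G,G]\cong\mathbb{Z}$, $\chi:G\to\mathbb{Z}$ is an abelianization map (a surjective group morphism with kernel $[G,G]$) and $z\in Z(G)\cap[G,G]$, then the skew brace $(G,\cdot,\bullet_z)$ with $a\bullet_z b=a\cdot b\cdot z^{\chi(a)\chi(b)}$ is bi-skew.
   Context: A skew brace is a triple $(A,\cdot,\bullet)$ where $A^{\cdot}=(A,\cdot)$ and $A^{\bullet}=(A,\bullet)$ are groups with the same identity $1$ such that $a\bullet(b\cdot c)=(a\bullet b)\cdot a^{-1}\cdot(a\bullet c)$ for all $a,b,c\in A$, where $a^{-1}$ is the inverse in $A^{\cdot}$. It is two-sided if in addition $(a\cdot b)\bullet c=(a\bullet c)\cdot c^{-1}\cdot(b\bullet c)$ for all $a,b,c$. It is bi-skew if $(A,\bullet,\cdot)$ is also a skew brace. Put $\lambda_a(b):=a^{-1}\cdot(a\bullet b)$, which for every $a$ defines an automorphism $\lambda_a$ of $A^{\cdot}$. The $\star$-product is $a\star b:=a^{-1}\cdot(a\bullet b)\cdot b^{-1}$. For associative $\star$, $P_3(A)$ is the subgroup of $A^{\cdot}$ generated by all triple products $a\star b\star c$, $a,b,c\in A$. *)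

(* Defs.v *)
From HB Require Import structures.
From mathcomp Require Import all_boot all_order all_algebra.
From mathcomp Require Import boolp classical_sets.
Set Implicit Arguments.
Unset Strict Implicit.
Unset Printing Implicit Defensive.
Local Open Scope classical_set_scope.
Local Open Scope group_scope.

Section Groups.
Variable G : groupType.

Definition subgroup (H : set G) : Prop :=
  [/\ H 1, forall x y, H x -> H y -> H (x * y) & forall x, H x -> H x^-1].

Definition generated (X : set G) : set G := smallest subgroup X.

Definition derived : set G :=
  generated [set u | exists x y : G, u = [~ x, y]].

Definition center : set G := [set z | forall x : G, commute z x].

Definition zpow (x : G) (n : int) : G :=
  match n with Posz k => x ^+ k | Negz k => x ^- k.+1 end.

Definition abelianization_map (chi : G -> int) : Prop :=
  [/\ {morph chi : a b / a * b >-> (a + b)%R},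
      forall n : int, exists a : G, chi a = n
    & [set a | chi a = 0%R] = derived].

End Groups.

Arguments derived : clear implicits.
Arguments center : clear implicits.

Section Aut.
Variable G : groupType.

Record aut := Aut {
  aut_fun :> G -> G;
  aut_bij : bijective aut_fun;
  autM : {morph aut_fun : x y / x * y} }.

HB.instance Definition _ := gen_eqMixin aut.
HB.instance Definition _ := gen_choiceMixin aut.

Lemma aut_ext (f g : aut) : f =1 g -> f = g.
Proof.
case: f g => f bf mf [g bg mg] /= /funext fg; subst g.
by congr Aut; exact: Prop_irrelevance.
Qed.

Definition aut_id : aut :=
  @Aut id (Bijective (fun=> erefl) (fun=> erefl)) (fun _ _ => erefl).

Definition aut_comp (f g : aut) : aut.
Proof.
exists (f \o g); first exact: bij_comp (aut_bij f) (aut_bij g).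
by move=> x y /=; rewrite !autM.
Defined.

Lemma aut_inv_subproof (f : aut) :
  {g : aut | (forall x, g (f x) = x) /\ (forall x, f (g x) = x)}.
Proof.
apply: cid; have [g fK gK] := aut_bij f.
suff gM : {morph g : x y / x * y}.
  by exists (Aut (Bijective gK fK) gM).
by move=> x y; rewrite -{1}(gK x) -{1}(gK y) -autM fK.
Qed.

Definition aut_inv (f : aut) : aut := sval (aut_inv_subproof f).

Lemma aut_compA : associative aut_comp.
Proof. by move=> f g h; exact: aut_ext. Qed.

Lemma aut_comp1f : left_id aut_id aut_comp.
Proof. by move=> f; exact: aut_ext. Qed.

Lemma aut_compf1 : right_id aut_id aut_comp.
Proof. by move=> f; exact: aut_ext. Qed.

Lemma aut_compVf : left_inverse aut_id aut_inv aut_comp.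
Proof.
move=> f; apply: aut_ext => x /=.
by rewrite /aut_inv; case: aut_inv_subproof => g [].
Qed.

Lemma aut_compfV : right_inverse aut_id aut_inv aut_comp.
Proof.
move=> f; apply: aut_ext => x /=.
by rewrite /aut_inv; case: aut_inv_subproof => g [].
Qed.

(* The product [f * g] in [aut] is the composition [f \o g]. *)
HB.instance Definition _ :=
  isGroup.Build aut aut_compA aut_comp1f aut_compf1 aut_compVf aut_compfV.

End Aut.

(* [B : skewBrace A] is a skew brace whose first group is [A]; [circ B] is the
   second operation, a group law on the carrier of [A] with the same identity. *)
Record skewBrace (A : groupType) := SkewBrace {
  circ : A -> A -> A;
  circ_inv : A -> A;
  circA : associative circ;
  circ1g : left_id 1 circ;
  circg1 : right_id 1 circ;
  circVg : left_inverse 1 circ_inv circ;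
  circgV : right_inverse 1 circ_inv circ;
  circM : forall a b c : A, circ a (b * c) = circ a b * a^-1 * circ a c }.

(* The carrier of [A], with [circ B] as its canonical group law. *)
Definition circ_group (A : groupType) (B : skewBrace A) : Type := A.

HB.instance Definition _ (A : groupType) (B : skewBrace A) :=
  Choice.copy (circ_group B) A.
HB.instance Definition _ (A : groupType) (B : skewBrace A) :=
  isGroup.Build (circ_group B)
    (circA B) (circ1g B) (circg1 B) (circVg B) (circgV B).

Section SkewBrace.
Variables (A : groupType) (B : skewBrace A).

Definition two_sided : Prop :=
  forall a b c : A, circ B (a * b) c = circ B a c * c^-1 * circ B b c.

Definition bi_skew : Prop :=
  exists B' : skewBrace (circ_group B : groupType),
    forall a b : A, circ B' a b = a * b :> A.

Definition star (a b : A) : A := a^-1 * circ B a b * b^-1.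

(* Only meaningful when [star] is associative. *)
Definition P3 : set A :=
  generated [set u | exists a b c : A, u = star (star a b) c].

Definition lam_fun (a b : A) : A := a^-1 * circ B a b.

Lemma lam_bij a : bijective (lam_fun a).
Proof.
exists (fun b => circ B (circ_inv B a) (a * b)) => b; rewrite /lam_fun.
  by rewrite mulVKg circA circVg circ1g.
by rewrite circA circgV circ1g mulKg.
Qed.

Lemma lamM a : {morph lam_fun a : b c / b * c}.
Proof. by move=> b c; rewrite /lam_fun circM !mulgA. Qed.

Definition lam (a : A) : aut A := Aut (lam_bij a) (@lamM a).

End SkewBrace.

(* Main.v *)
Require Import Defs.
From HB Require Import structures.
From mathcomp Require Import all_boot all_order all_algebra.
From mathcomp Require Import boolp classical_sets.
Set Implicit Arguments.
Unset Strict Implicit.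
Unset Printing Implicit Defensive.
Local Open Scope classical_set_scope.
Local Open Scope group_scope.

(** Write L for lambda and ∘ for the circle operation. The skew brace axiom makes
L a homomorphism from the circle group, L (a ∘ b) = L a L b, and expanding the
axiom for the reversed pair of operations shows that the brace is bi-skew
exactly when L (a b) = L b L a ([bi_skewP]). So the first two conditions say
that L is an antimorphism, resp. a morphism, on the first group, and the task
is to compare each with the vanishing of all triples a ⋆ b ⋆ c.

If the triples vanish, comparing the two expansions of a ∘ b ∘ c
([star_exchange]) shows that star products commute with one another and then
that they are central ([stars_central]). Two-sidedness gives
(ab) ⋆ c = (a ⋆ c)^b (b ⋆ c), so L (a b) c, L a (L b c) and L b (L a c) are all
equal to (a ⋆ c)(b ⋆ c)c: L is both a morphism and an antimorphism.

If L is a morphism, then L (a ∘ b) = L (a b), and as a ∘ b = a (a ⋆ b) b this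
forces L (a ⋆ b) = 1, i.e. (a ⋆ b) ⋆ c = 1.

The remaining implication is the delicate one. If L is an antimorphism, then
L g acts on star products as conjugation by g ([lam_conj]), so the triples
vanish as soon as star products are central. Comparing L (a ∘ a) with L (a a)
yields L (a ⋆ a) = 1, so by associativity a ⋆ (a ⋆ c) = 1, which means that a
commutes with a ⋆ c ([conj_star_left]). Replacing a by a b in this fact makes
the triple a ⋆ b ⋆ c essentially antisymmetric in a and b
([conj_star_swap]); with it b ⋆ (a ⋆ b) lies in the kernel of L and b commutes
with a ⋆ b ⋆ c ([conj_star_third]). Once these commutations are inserted in
[star_exchange], it says that a ⋆ c is fixed by an explicit element, whose
action simplifies to that of b (b ⋆ c); varying b makes a ⋆ c central
([anti_central]).

For the twisted operation on G, central powers of z only contribute exponents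
and chi z = 0, so L a b = b z^(chi a chi b) with the factor invisible to chi:
composing two such maps adds the values chi a, and L is an antimorphism. *)

(** * Groups *)

(** Free reduction of left-associated words: with conjugates unfolded and
inverses pushed to the letters, two words equal in the free group become
syntactically equal. Subterms that unfold to products must be generalized
before it is used. *)
Ltac group_nf :=
  rewrite ?conjgE ?(invgM, invgK, invg1, mulgA, mulg1, mul1g,
                    mulgV, mulVg, mulgK, mulgVK).

Lemma generated_eq1 (G : groupType) (X : set G) :
  generated X = [set 1] <-> forall x, X x -> x = 1.
Proof.
split=> [gX x Xx | X1].
  suff : generated X x by rewrite gX.
  by move=> H [_ XH]; exact: XH.
apply/seteqP; split=> x /=; last by move=> -> H [[]].
move=> /(_ [set 1]); apply; split=> //.
by split=> [|_ _ -> ->|_ ->]; rewrite ?mulg1 ?invg1.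
Qed.

Lemma conjg_commute (G : groupType) (x y : G) : commute x y <-> x ^ y = x.
Proof.
split=> [xy | xy]; first by rewrite conjgE xy mulKg.
by rewrite /commute -[in RHS]xy conjgE mulVKg.
Qed.

(** * Skew braces and bi-skew braces *)

Section SkewBraceTheory.
Variables (A : groupType) (B : skewBrace A).
Implicit Types a b c g x y : A.

Local Notation L := (lam_fun B).
Local Notation "a ⋆ b" := (star B a b) (at level 38, left associativity).

Lemma circE a b : circ B a b = a * L a b.
Proof. by rewrite /lam_fun mulVKg. Qed.

Lemma lam_star a b : L a b = a ⋆ b * b.
Proof. by rewrite /star mulgVK. Qed.

Lemma circ_star a b : circ B a b = a * a ⋆ b * b.
Proof. by rewrite circE lam_star mulgA. Qed.

Lemma lam1l b : L 1 b = b.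
Proof. by rewrite /lam_fun circ1g invg1 mul1g. Qed.

Lemma star_eq1 a b : a ⋆ b = 1 <-> L a b = b.
Proof.
rewrite lam_star; split=> [->|/(congr1 (fun u => u * b^-1))].
  exact: mul1g.
by rewrite mulgK mulgV.
Qed.

Lemma lam_circ a b c : L (circ B a b) c = L a (L b c).
Proof.
by apply: (mulgI (circ B a b)); rewrite -circE -circA !circE lamM !mulgA.
Qed.

Lemma lam_inj a : injective (L a).
Proof. exact: bij_inj (lam_bij B a). Qed.

Lemma lam_surj a c : exists d, L a d = c.
Proof. by have [h _ hK] := lam_bij B a; exists (h c); exact: hK. Qed.

Lemma star_mulr a b c : a ⋆ (b * c) = a ⋆ b * (a ⋆ c) ^ b^-1.
Proof.
by apply: (mulIg (b * c)); rewrite -lam_star lamM !lam_star; group_nf.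
Qed.

Definition lam_anti := forall a b c, L (a * b) c = L b (L a c).

(** Substitute L a c for c in the compatibility axiom of the reversed pair:
since a (L a c) = a ∘ c, the circle inverse of a cancels and the axiom becomes
the comparison of (a b) L b (L a c) with (a b) ∘ c. *)
Lemma bi_skewP : bi_skew B <-> lam_anti.
Proof.
have circKV a c : a * c = circ B a (circ B (circ_inv B a) (a * c)).
  by rewrite circA circgV circ1g.
split=> [[B' B'E] a b c | anti].
  have : a * circ B b (L a c) =
      circ B (circ B (a * b) (circ_inv B a)) (a * L a c).
    by rewrite -!B'E; exact: (circM B' a b (L a c)).
  rewrite -circA -(circE a c) [circ B (circ_inv B a) _]circA circVg circ1g.
  by rewrite !circE mulgA => /mulgI.
have distr a b c : a * circ B b c =
    circ B (circ B (a * b) (circ_inv B a)) (a * c).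
  rewrite -circA; set w := circ B _ (a * c).
  have : a * c = circ B a w by rewrite -circKV.
  by rewrite circE => /mulgI ->; rewrite !circE anti mulgA.
by exists (@SkewBrace (circ_group B) _ _ (@mulgA A) (@mul1g A) (@mulg1 A)
  (@mulVg A) (@mulgV A) distr).
Qed.

(** * Two-sided skew braces *)

Section TwoSided.
Hypothesis two : two_sided B.

Lemma star_mull a b c : (a * b) ⋆ c = (a ⋆ c) ^ b * b ⋆ c.
Proof. by rewrite /star two; group_nf. Qed.

(** The associativity of the circle operation: both sides are what remains of
a ∘ (b ∘ c) and (a ∘ b) ∘ c after cancelling a on the left and c on the right.
The triple product appears on both sides, so only its position matters once
the star product is associative. *)
Lemma star_exchange a b c :
  a ⋆ b * b * a ⋆ (b ⋆ c) * b ⋆ c * a ⋆ c =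
  a ⋆ c * a ⋆ b * a ⋆ b ⋆ c * b * b ⋆ c.
Proof.
have := circA B a b c; rewrite [LHS]circ_star [RHS]circ_star.
rewrite (circ_star b c) (circ_star a b) !star_mulr // !star_mull.
move: (a ⋆ b) (a ⋆ c) (b ⋆ c) (a ⋆ (b ⋆ c)) (a ⋆ b ⋆ c) => x s y t t'.
by group_nf => /mulIg; rewrite -!mulgA => /mulgI; rewrite !mulgA.
Qed.

(** With trivial triples, [star_exchange] at a star product b says that star
products commute; this allows the remaining factors of [star_exchange] to be
cancelled for general b, leaving b (a ⋆ c) = (a ⋆ c) b. *)
Lemma stars_central : (forall a b c, a ⋆ b ⋆ c = 1) ->
  (forall a b c, a ⋆ (b ⋆ c) = 1) -> forall a b c, commute (a ⋆ c) b.
Proof.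
move=> t1 t2.
have comm a c u v : commute (a ⋆ c) (u ⋆ v).
  have := star_exchange a (u ⋆ v) c.
  by rewrite (t2 a _ c) !t1 (t2 a u v) !mulg1 !mul1g => /esym.
move=> a b c; have := star_exchange a b c; rewrite t1 t2 !mulg1.
have := comm b c a c; have := comm a c a b.
move: (a ⋆ b) (a ⋆ c) (b ⋆ c) => x s y sx ys.
by rewrite -[_ * y * s]mulgA ys mulgA => /mulIg; rewrite sx -!mulgA => /mulgI.
Qed.

End TwoSided.

(** Since a ∘ b = a (a ⋆ b) b, a morphism L sends a ∘ b to
L a (L (a ⋆ b)) L b, while L (a ∘ b) = L a L b always holds: L kills a ⋆ b. *)
Lemma lam_morph_trivial :
  (forall a b c, L (a * b) c = L a (L b c)) -> forall a b c, a ⋆ b ⋆ c = 1.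
Proof.
move=> hom a b c; apply/star_eq1.
have [d <-] := lam_surj b c; apply: (@lam_inj a).
by rewrite -[RHS]lam_circ circ_star !hom.
Qed.

Lemma lam_lam a b c : a ⋆ (b ⋆ c) = 1 -> L a (L b c) = b ⋆ c * a ⋆ c * c.
Proof.
by move/star_eq1 => ab; rewrite (lam_star b) lamM ab lam_star mulgA.
Qed.

(** * Antimorphic lambda with an associative star product *)

Section Anti.
Hypotheses (two : two_sided B) (assoc : associative (star B)).
Hypothesis anti : lam_anti.

(** Split L a c = (a ⋆ c) c in L (a g) c = L g (L a c), and compare with
L (a g) c = ((a g) ⋆ c) c = (a ⋆ c)^g (g ⋆ c) c. *)
Lemma lam_conj g a c : L g (a ⋆ c) = (a ⋆ c) ^ g.
Proof.
have := anti a g c; rewrite (lam_star a c) lamM (lam_star _ c).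
rewrite (lam_star g c) star_mull //.
move: (L g (a ⋆ c)) (a ⋆ c) (g ⋆ c) => l s y.
by rewrite mulgA => /mulIg/mulIg.
Qed.

Lemma star_conj g a c : g ⋆ (a ⋆ c) = (a ⋆ c) ^ g * (a ⋆ c)^-1.
Proof. by rewrite -lam_conj lam_star mulgK. Qed.

Lemma star_conj_fixed g a c : g ⋆ (a ⋆ c) = 1 <-> (a ⋆ c) ^ g = a ⋆ c.
Proof. by rewrite star_eq1 lam_conj. Qed.

(** Conjugation by a (a ⋆ b) b = a ∘ b is L (a ∘ b) = L a L b on star products,
and L a L b is conjugation by b a there, because (u ⋆ v)^b is the product of
the two star products b ⋆ (u ⋆ v) and u ⋆ v. *)
Lemma conj_star a b u v : (u ⋆ v) ^ (a * a ⋆ b * b) = (u ⋆ v) ^ (b * a).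
Proof.
rewrite -circ_star -lam_conj lam_circ lam_conj.
have -> : (u ⋆ v) ^ b = b ⋆ (u ⋆ v) * u ⋆ v by rewrite star_conj mulgVK.
by rewrite lamM !lam_conj -conjMg star_conj mulgVK conjgM.
Qed.

(** L a (L (a ⋆ a)) L a = L (a (a ⋆ a) a) = L (a ∘ a) = L a L a. *)
Lemma lam_starxx a c : L (a ⋆ a) c = c.
Proof.
have [d <-] := lam_surj a c; apply: (@lam_inj a).
by rewrite -[RHS]lam_circ circ_star !anti.
Qed.

(** By [star_conj_fixed] it suffices that a ⋆ (a ⋆ c) = (a ⋆ a) ⋆ c is trivial. *)
Lemma conj_star_left a c : (a ⋆ c) ^ a = a ⋆ c.
Proof. by apply/star_conj_fixed; rewrite assoc; apply/star_eq1/lam_starxx. Qed.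

(** The linearization of [conj_star_left]: expand the fact that a b commutes
with (a b) ⋆ c and use that a commutes with a ⋆ c and b with b ⋆ c. *)
Lemma conj_star_swap a b c :
  (a ⋆ c)^-1 * (a ⋆ c) ^ b = (b ⋆ c) ^ a^-1 * (b ⋆ c)^-1.
Proof.
have := conj_star_left (a * b) c; have := conj_star_left a c.
have := conj_star_left b c; rewrite star_mull // -!conjg_commute /commute.
move: (a ⋆ c) (b ⋆ c) => s y yb sa; group_nf => e.
apply: (mulgI s); apply: (mulIg (y * a * b)); group_nf.
by rewrite e -sa -!mulgA yb.
Qed.

(** By [star_conj_fixed] and associativity the claim is that b ⋆ (a ⋆ b) is in
the kernel of L. By [conj_star_swap] with c = b this element is a product of
conjugates of b ⋆ b and its inverse, and b ⋆ b is in the kernel, which is a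
normal subgroup because L is an antimorphism. *)
Lemma conj_star_third a b c : (a ⋆ (b ⋆ c)) ^ b = a ⋆ (b ⋆ c).
Proof.
rewrite assoc -star_conj_fixed assoc; apply/star_eq1.
have kerJ k g : (forall d, L k d = d) -> forall d, L (k ^ g) d = d.
  move=> kk d; rewrite conjgE !anti kk.
  by rewrite -anti mulVg lam1l.
have kerV k : (forall d, L k d = d) -> forall d, L k^-1 d = d.
  by move=> kk d; rewrite -{1}(kk d) -anti mulgV lam1l.
have kerM k l : (forall d, L k d = d) -> (forall d, L l d = d) ->
    forall d, L (k * l) d = d by move=> kk ll d; rewrite anti kk ll.
have -> : b ⋆ (a ⋆ b) =
    ((b ⋆ b) ^ a^-1 * (b ⋆ b)^-1) ^ (a ⋆ b)^-1.
  rewrite star_conj -conj_star_swap.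
  by move: (a ⋆ b) => s; group_nf.
apply/kerJ/kerM; first by apply: kerJ => d; exact: lam_starxx.
by apply: kerV => d; exact: lam_starxx.
Qed.

(** Write s = a ⋆ c, y = u ⋆ c. As u commutes with a ⋆ y, [star_exchange] says
that s commutes with (a ⋆ u) u (a ⋆ y) y = (a ⋆ u) u y^a. By [conj_star] and
s^a = s this element acts on s as u a y^a = u y a, so u y fixes s. A second use
of [conj_star], now for u and c, shows that s^c is fixed by every u. *)
Lemma anti_central a b c : commute (a ⋆ c) b.
Proof.
have conj_circ u : (a ⋆ c) ^ (u * u ⋆ c) = a ⋆ c.
  have sg : commute (a ⋆ c) (a ⋆ u * u * (u ⋆ c) ^ a).
    rewrite /commute -lam_conj lam_star.
    have := star_exchange two a u c; rewrite -assoc.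
    have := conj_star_third a u c; rewrite -conjg_commute /commute.
    move: (a ⋆ u) (a ⋆ c) (u ⋆ c) (a ⋆ (u ⋆ c)) => x s y t tu.
    rewrite !mulgA => ->.
    by rewrite -!mulgA (mulgA t) tu !mulgA.
  have su : (a ⋆ c) ^ (a ⋆ u * u) = (a ⋆ c) ^ (u * a).
    by rewrite -(conj_star a u) -(mulgA a) (conjgM _ a) conj_star_left.
  apply: (@conjg_inj _ a); rewrite conj_star_left.
  move/conjg_commute: sg; rewrite conjgM su -!conjgM => {2}<-.
  by congr (_ ^ _); move: (u ⋆ c) => y; group_nf.
have conj_c u : (a ⋆ c) ^ c = ((a ⋆ c) ^ c) ^ u.
  by rewrite -conjgM -(conj_star u c) (conjgM _ _ c) conj_circ.
(* The case u = c of conj_c. *)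
have sc : (a ⋆ c) ^ c = a ⋆ c by apply: (@conjg_inj _ c); rewrite -conj_c.
by apply/conjg_commute; rewrite -[in LHS]sc -conj_c.
Qed.

End Anti.
End SkewBraceTheory.

(** * Integer powers *)

Section Zpow.
Variable G : groupType.
Implicit Types (x : G) (m n : int).

Lemma zpowS x n : zpow x (n + 1)%R = zpow x n * x.
Proof.
case: n => [n|[|n]]; rewrite /zpow.
- by rewrite -PoszD addn1 expgSr.
- by rewrite expg1 mulVg.
- have -> : (Negz n.+1 + 1 = Negz n)%R.
    by rewrite !NegzE -(addn1 n.+1) PoszD GRing.opprD GRing.addrNK.
  by rewrite [in RHS]expgS invgM mulgVK.
Qed.

Lemma zpowB1 x n : zpow x (n - 1)%R = zpow x n * x^-1.
Proof. by rewrite -{2}(GRing.subrK 1%R n) zpowS mulgK. Qed.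

Lemma zpowD x m n : zpow x (m + n)%R = zpow x m * zpow x n.
Proof.
elim/int_rec: n => [|n IH|n IH].
- by rewrite GRing.addr0 mulg1.
- by rewrite -addn1 PoszD GRing.addrA !zpowS IH mulgA.
- by rewrite -addn1 PoszD GRing.opprD GRing.addrA !zpowB1 IH mulgA.
Qed.

Lemma zpow_central x n : center G x -> center G (zpow x n).
Proof.
move=> xZ y; have yx : commute y x by apply: commute_sym.
by apply: commute_sym; case: n => n; rewrite /zpow;
  try apply: commuteV; apply: commuteX.
Qed.

End Zpow.

(** * Twisting a group by a central element *)

Section Twist.
Variables (G : groupType) (chi : G -> int) (z : G).
Hypotheses (chiM : {morph chi : a b / a * b >-> (a + b)%R}).
Hypotheses (zZ : center G z) (chiz : chi z = 0%R).
Local Notation zc a b := (zpow z (chi a * chi b)%R).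
Local Notation op := (fun a b : G => a * b * zc a b).

Lemma chi1 : chi 1 = 0%R.
Proof.
by apply: (GRing.addrI (chi 1)); rewrite -chiM mulg1 GRing.addr0.
Qed.

Lemma chiV a : chi a^-1 = (- chi a)%R.
Proof.
by apply: (GRing.addrI (chi a)); rewrite -chiM mulgV chi1 GRing.addrN.
Qed.

Lemma chi_zpow n : chi (zpow z n) = 0%R.
Proof.
elim/int_rec: n => [|n IH|n IH]; first exact: chi1.
  by rewrite -addn1 PoszD zpowS chiM IH chiz.
by rewrite -addn1 PoszD GRing.opprD zpowB1 chiM chiV IH chiz.
Qed.

Lemma chi_twist a b : chi (op a b) = (chi a + chi b)%R.
Proof. by rewrite !chiM chi_zpow GRing.addr0. Qed.

Definition twist_inv a := a^-1 * zc a a.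

Lemma zcC a b x : zc a b * x = x * zc a b.
Proof. exact: zpow_central. Qed.

Lemma twistA : associative op.
Proof.
move=> a b c /=; rewrite !chi_twist GRing.mulrDr GRing.mulrDl !zpowD.
have := zcC b c; have := zcC a c; have := zcC a b.
move: (zc a b) (zc a c) (zc b c) => u v w uC vC wC.
rewrite -!mulgA; do 2!congr (_ * _).
by rewrite (uC (c * _)) -!mulgA (vC (w * u)) -!mulgA.
Qed.

Lemma twist1g : left_id 1 op.
Proof. by move=> a; rewrite /= chi1 GRing.mul0r mul1g mulg1. Qed.

Lemma twistg1 : right_id 1 op.
Proof. by move=> a; rewrite /= chi1 GRing.mulr0 !mulg1. Qed.

Lemma chi_twist_inv a : chi (twist_inv a) = (- chi a)%R.
Proof. by rewrite chiM chi_zpow GRing.addr0 chiV. Qed.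

Lemma twistVg : left_inverse 1 twist_inv op.
Proof.
move=> a /=; rewrite chi_twist_inv /twist_inv -(mulgA a^-1) zcC mulgA mulVg mul1g.
by rewrite -zpowD GRing.mulNr GRing.addrN.
Qed.

Lemma twistgV : right_inverse 1 twist_inv op.
Proof.
move=> a /=; rewrite chi_twist_inv /twist_inv mulgA mulgV mul1g -zpowD.
by rewrite GRing.mulrN GRing.addrN.
Qed.

Lemma twistM a b c : op a (b * c) = op a b * a^-1 * op a c.
Proof.
rewrite /= chiM GRing.mulrDr zpowD; group_nf.
by rewrite -(mulgA (a * b) (zc a b) c) zcC mulgA.
Qed.

Definition twist := SkewBrace twistA twist1g twistg1 twistVg twistgV twistM.

Lemma lam_twist a b : lam_fun twist a b = b * zc a b.
Proof. by rewrite /lam_fun /= -mulgA mulKg. Qed.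

Lemma twist_bi_skew : bi_skew twist.
Proof.
apply/bi_skewP => a b c.
by rewrite !lam_twist !chiM chi_zpow GRing.addr0 GRing.mulrDl zpowD mulgA.
Qed.

End Twist.

(** * The equivalence *)

Theorem corollary4p16 :
  (forall (A : groupType) (B : skewBrace A),
     two_sided B -> associative (star B) ->
     [<-> bi_skew B;
          monoid_morphism (lam B : A -> aut A);
          P3 B = [set 1]])
  /\
  (forall (G : groupType) (chi : G -> int) (z : G),
     abelianization_map chi -> center G z -> derived G z ->
     exists B : skewBrace G,
       (forall a b : G, circ B a b = a * b * zpow z (chi a * chi b)%R) /\
       bi_skew B).
Proof.
split=> [A B two assoc | G chi z [chiM _ kerchi] zZ zG]; last first.
  have chiz : chi z = 0%R by rewrite -[_ = _]/([set a | chi a = 0%R] z) kerchi.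
  by exists (twist chiM zZ chiz); split=> //; exact: twist_bi_skew.
have central_of_P3 : P3 B = [set 1] -> (forall a b c, star B (star B a b) c = 1)
    /\ forall a b c, commute (star B a c) b.
  move=> /generated_eq1 P31.
  have t a b c : star B (star B a b) c = 1 by apply: P31; exists a, b, c.
  by split=> //; apply: stars_central => // a b c; rewrite assoc.
have P3_of_trivial :
    (forall a b c, star B (star B a b) c = 1) -> P3 B = [set 1].
  by move=> t; apply/generated_eq1 => _ [a [b [c ->]]].
tfae=> [/bi_skewP anti | [_ hom] | /central_of_P3[t central]].
- have sZ a b c : commute (star B a c) b by exact: anti_central.
  have t a b c : star B (star B a b) c = 1.
    rewrite -assoc; apply/star_eq1.
    by rewrite lam_conj //; apply/conjg_commute.
  split; first by apply: aut_ext => c; exact: lam1l.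
  move=> a b; apply: aut_ext => c /=.
  by rewrite anti !lam_lam ?assoc ?t // (sZ a).
- apply: P3_of_trivial; apply: lam_morph_trivial => a b c.
  by rewrite -[LHS]/(lam B (a * b) c) hom.
apply/bi_skewP => a b c.
rewrite lam_lam ?assoc ?t // lam_star star_mull //.
by have /conjg_commute-> := central a b c.
Qed.
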